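(* The equivalence classes of numbers under the relation $=$, with addition and multiplication induced by the sum and product of numbers and with the order induced by $<$, form a totally ordered FIELD (a totally ordered field whose underlying collection may be a proper class).
   Context: A game is an ordered pair $G=(L,R)$ of sets of games, where $L$ is the set of left options and $R$ the set of right options, subject to the Descending Game Condition: there is no infinite sequence of games $G^0,G^1,G^2,\dots$ in which every $G^{i+1}$ is a left or right option of $G^i$. The sets $L,R$ may be empty or infinite. One writes $G=\{G^L,\dots\mid G^R,\dots\}$, where $G^L$ and $G^R$ denote arbitrary left and right options of $G$. Order, defined recursively: $G\ge 0$ iff there is no right option $G^R$ with $G^R\le 0$; $G\le 0$ iff there is no left option $G^L$ with $G^L\ge 0$. Then $G=0$ means $G\ge 0$ and $G\le 0$; $G>0$ means $G\ge 0$ and not $G\le 0$; $G<0$ means $G\le 0$ and not $G\ge 0$. Arithmetic, defined recursively: $G+H$ is the game with left options all $G^L+H$ and all $G+H^L$, and right options all $G^R+H$ and all $G+H^R$; $-G$ is the game with left options all $-G^R$ and right options all $-G^L$; $G-H$ is $G+(-H)$. For two games, $G=H$ means $G-H=0$, $G>H$ means $G-H>0$, and so on. The relation $=$ is a defined equivalence relation, not set-theoretic identity. Numbers (recursive definition): a game $x$ is a number if all left and right options of $x$ are numbers and $x^L<x^R$ for every left option $x^L$ and every right option $x^R$. Product of numbers $x,y$ (recursive definition): $xy$ is the game whose left options are all $x^Ly+xy^L-x^Ly^L$ (one for each pair $(x^L,y^L)$) and all $x^Ry+xy^R-x^Ry^R$ (one for each pair $(x^R,y^R)$), and whose right options are all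 $x^Ly+xy^R-x^Ly^R$ (pairs $(x^L,y^R)$) and all $x^Ry+xy^L-x^Ry^L$ (pairs $(x^R,y^L)$). The zero is represented by $0=\{\,\mid\,\}$ and the one by $1=\{0\mid\,\}$. *)

(* Defs.v *)
From mathcomp Require Import all_boot all_order all_algebra.

Set Implicit Arguments.
Unset Strict Implicit.
Unset Printing Implicit Defensive.

(* A set of options is given as a family indexed by a type of the universe    *)
(* below that of [game]: types of that lower universe play the role of sets,  *)
(* and [game] itself that of a proper class. Index types may be empty or      *)
(* infinite, and repetitions in a family are harmless, since everything below *)
(* only quantifies over options. The Descending Game Condition is the         *)
(* well-foundedness of the inductive type, see [descending_game_condition].   *)
Inductive game : Type :=
  Game (L R : Type) (left : L -> game) (right : R -> game).

Definition is_option (H G : game) : Prop :=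
  match G with
  | Game _ _ gl gr => (exists i, H = gl i) \/ (exists j, H = gr j)
  end.

Lemma descending_game_condition (G : nat -> game) :
  ~ (forall i, is_option (G i.+1) (G i)).
Proof.
move=> optG; suff noG g : forall i, G i <> g by exact: (noG (G 0) 0).
elim: g => L R gl IHl gr IHr i Gi.
have := optG i; rewrite Gi /= => -[[a Ga]|[b Gb]]; first exact: IHl Ga.
exact: IHr Gb.
Qed.

Fixpoint game_ge0 (G : game) : Prop :=
  match G with Game _ R _ gr => ~ exists j : R, game_le0 (gr j) end
with game_le0 (G : game) : Prop :=
  match G with Game L _ gl _ => ~ exists i : L, game_ge0 (gl i) end.

Definition game_eq0 (G : game) : Prop := game_ge0 G /\ game_le0 G.
Definition game_lt0 (G : game) : Prop := game_le0 G /\ ~ game_ge0 G.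

Fixpoint game_add (G : game) : game -> game :=
  match G with
  | Game GL GR gl gr =>
    fix addG (H : game) : game :=
      match H with
      | Game HL HR hl hr =>
        Game
          (fun i : GL + HL =>
             match i with
             | inl a => game_add (gl a) H
             | inr b => addG (hl b)
             end)
          (fun j : GR + HR =>
             match j with
             | inl a => game_add (gr a) H
             | inr b => addG (hr b)
             end)
      end
  end.

Fixpoint game_opp (G : game) : game :=
  match G with
  | Game _ _ gl gr =>
    Game (fun j => game_opp (gr j)) (fun i => game_opp (gl i))
  end.

Definition game_sub (G H : game) : game := game_add G (game_opp H).

Definition game_eq (G H : game) : Prop := game_eq0 (game_sub G H).
Definition game_lt (G H : game) : Prop := game_lt0 (game_sub G H).

Fixpoint is_number (x : game) : Prop :=
  match x with
  | Game _ _ xl xr =>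
    [/\ forall i, is_number (xl i),
        forall j, is_number (xr j)
      & forall i j, game_lt (xl i) (xr j)]
  end.

(* The recursive formula makes sense for all games; it is only meaningful on  *)
(* numbers, whose options are again numbers.                                  *)
Fixpoint game_mul (x : game) : game -> game :=
  match x with
  | Game XL XR xl xr =>
    fix mulx (y : game) : game :=
      match y with
      | Game YL YR yl yr =>
        Game
          (fun k : XL * YL + XR * YR =>
             match k with
             | inl (i, j) =>
               game_sub (game_add (game_mul (xl i) y) (mulx (yl j)))
                        (game_mul (xl i) (yl j))
             | inr (i, j) =>
               game_sub (game_add (game_mul (xr i) y) (mulx (yr j)))
                        (game_mul (xr i) (yr j))
             end)
          (fun k : XL * YR + XR * YL =>
             match k with
             | inl (i, j) =>
               game_sub (game_add (game_mul (xl i) y) (mulx (yr j)))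
                        (game_mul (xl i) (yr j))
             | inr (i, j) =>
               game_sub (game_add (game_mul (xr i) y) (mulx (yl j)))
                        (game_mul (xr i) (yl j))
             end)
      end
  end.

Definition game0 : game :=
  Game (fun i : void => match i with end) (fun j : void => match j with end).
Definition game1 : game :=
  Game (fun _ : unit => game0) (fun j : void => match j with end).

Definition number_class (x : game) : game -> Prop :=
  fun y => is_number y /\ game_eq x y.

Definition surreal : Type :=
  {c : game -> Prop | exists2 x, is_number x & c = number_class x}.

(* Only numbers represent a class. Hence, for an operation [op] on classes,   *)
(* asking that [game_add x y] represent [op a b] whenever [x] represents [a]  *)
(* and [y] represents [b] says at once that numbers are closed under addition,*)
(* that addition is compatible with [game_eq], and that [op] is the induced   *)
(* operation.                                                                 *)
Definition represents (x : game) (a : surreal) : Prop := sval a x.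

(* Main.v *)
From Stdlib Require Import Permutation Relation_Operators Transitive_Closure.
From Stdlib Require Import List_Extension.
Require Import Defs.
From mathcomp Require Import all_boot all_order all_algebra.
From mathcomp Require Import boolp ring lra.
From Corelib Require Import RelationClasses.
From HB Require Import structures.
Import Order.TTheory GRing.Theory Num.Theory.
Local Open Scope ring_scope.

Set Implicit Arguments.
Unset Strict Implicit.
Unset Printing Implicit Defensive.

(** Write [x <= y] for [x - y <= 0], which is [gle x y] below.  By induction on
    games this is the usual recursive order: [x <= y] fails exactly when some
    left option of [x] is at least [y] or some right option of [y] is at most
    [x] ([gleE]).  Hence it is a preorder invariant under translation, and all
    games modulo equality form a partially ordered abelian group [gvalue];
    [value x] is the class of [x].

    The ring identities (commutativity, associativity, distributivity, unit)
    hold in this group for ALL games, by induction: every option of one side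
    has the same value as an option of the other side, and options of equal
    value can be exchanged.  What fails for general games is that the product
    respects equality and order; this is where numbers come in.

    Options are treated with a sign: [opt b x x'] says that [x'] is a right
    option of [x] when [b] is true and a left option otherwise.  The option of
    [x * y] built from [x'] and [y'] lies on the side [c (+) d] when [x'] and
    [y'] lie on the sides [c] and [d], and the difference between [x * y] and
    this option is the value of [(x - x') * (y - y')].  So the rule of signs
    says what it means for an option of a product to be on the correct side,
    and the four cases of the definition become one.

    For numbers, two statements are proved together: [mul_number], that [x * y]
    is a number, and [mul_mono], that [x1 * y] depends only on the value of [x1]
    and that [(x2 - x1) * (y - y')] has the expected sign when [x1 < x2] and
    [y'] is an option of [y].  Each reduces to instances in which one of the
    games involved is replaced by finitely many of its options, that is, to
    smaller multisets of games ([simpler_wf], [mul_number_mono]).  This gives an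
    ordered commutative ring.

    For inverses ([represents_inv]), let [x] be a positive number whose positive
    options [x'] already have inverses.  Starting from [z = 0], the map sending
    [z] to [(1 + (x' - x) z) / x'] multiplies [1 - x z] by [(x' - x) / x'].  So
    iterating it yields approximations of the inverse from below and from above,
    according to the number of left options used, and the game having these
    approximations as left and right options is the inverse of [x]. *)

(** * Options and the order of games *)

Declare Scope game_scope.
Delimit Scope game_scope with game.
Local Open Scope game_scope.
Notation "x + y" := (game_add x y) : game_scope.
Notation "- x" := (game_opp x) : game_scope.
Notation "x - y" := (game_sub x y) : game_scope.
Notation "x * y" := (game_mul x y) : game_scope.
Bind Scope game_scope with game.

#[global] Arguments game_add : simpl never.
#[global] Arguments game_opp : simpl never.
#[global] Arguments game_mul : simpl never.

(** A relation rather than a pair of families, with the side as a boolean: the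
    options of sums and products can then be described without index types,
    and sides add up like signs. *)
Definition opt (right : bool) (x y : game) : Prop :=
  match x with
  | Game _ _ xl xr =>
    if right then exists j, y = xr j else exists i, y = xl i
  end.

Lemma game_ind_opt (P : game -> Prop) :
  (forall x, (forall b x', opt b x x' -> P x') -> P x) -> forall x, P x.
Proof.
move=> step; elim=> L R xl IHl xr IHr; apply: step => -[] x' [k ->].
  exact: IHr.
exact: IHl.
Qed.

Lemma opt_opp b x g : opt b (- x) g <-> exists2 x', opt (~~ b) x x' & g = - x'.
Proof.
case: x => L R xl xr; case: b; split.
- by case=> i ->; exists (xl i) => //; exists i.
- by case=> _ [i ->] ->; exists i.
- by case=> i ->; exists (xr i) => //; exists i.
- by case=> _ [i ->] ->; exists i.
Qed.

Lemma opt_add b x y g :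
  opt b (x + y) g <->
  (exists2 x', opt b x x' & g = x' + y) \/
  (exists2 y', opt b y y' & g = x + y').
Proof.
case: x y => XL XR xl xr [YL YR yl yr]; case: b; split.
- by case=> -[i|j] ->; [left; exists (xr i)|right; exists (yr j)];
    rewrite //; eexists.
- by case=> -[_ [k ->] ->]; [exists (inl k)|exists (inr k)].
- by case=> -[i|j] ->; [left; exists (xl i)|right; exists (yl j)];
    rewrite //; eexists.
- by case=> -[_ [k ->] ->]; [exists (inl k)|exists (inr k)].
Qed.

Lemma opt_mul b x y g :
  opt b (x * y) g <->
  exists c x' y', [/\ opt c x x', opt (b (+) c) y y'
                    & g = x' * y + x * y' - x' * y'].
Proof.
case: x y => XL XR xl xr [YL YR yl yr]; split.
  by case: b => -[[[i j]|[i j]] ->];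
    [exists false, (xl i), (yr j)|exists true, (xr i), (yl j)
    |exists false, (xl i), (yl j)|exists true, (xr i), (yr j)];
    split=> //; eexists.
by case: b => -[[] [_ [_ [[i ->] [j ->] ->]]]];
  [exists (inr (i, j))|exists (inl (i, j))
  |exists (inr (i, j))|exists (inl (i, j))].
Qed.

Lemma opt_game0 b g : ~ opt b game0 g.
Proof. by case: b => -[[]]. Qed.

Lemma opt_game1 b g : opt b game1 g <-> ~~ b /\ g = game0.
Proof. by case: b; split=> [[[]]|[]] // _ ->; exists tt. Qed.

Definition gle (x y : game) := game_le0 (x - y).

Lemma game_le0E x : game_le0 x <-> forall x', opt false x x' -> ~ game_ge0 x'.
Proof.
case: x => L R xl xr; split=> [nx _ [i ->] ge|nx [i ge]].
  by apply: nx; exists i.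
by apply: nx ge; exists i.
Qed.

Lemma game_ge0E x : game_ge0 x <-> forall x', opt true x x' -> ~ game_le0 x'.
Proof.
case: x => L R xl xr; split=> [nx _ [i ->] ge|nx [i ge]].
  by apply: nx; exists i.
by apply: nx ge; exists i.
Qed.

(** An option of [x - y] is, up to sign, an option of [y - x] on the other
    side; both roles of the pair are needed in the induction, since passing to
    an option exchanges the two conditions. *)
Lemma game_ge0_sub x y : game_ge0 (x - y) <-> gle y x.
Proof.
suff: (game_ge0 (x - y) <-> gle y x) /\ (game_ge0 (y - x) <-> gle x y) by case.
elim/game_ind_opt: x y => x IHx; elim/game_ind_opt => y IHy.
suff H u v :
    (forall b u', opt b u u' -> game_ge0 (v - u') <-> gle u' v) ->
    (forall b v', opt b v v' -> game_ge0 (v' - u) <-> gle u v') ->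
    game_ge0 (u - v) <-> gle v u.
  split; apply: H => b z bz.
  - exact: (proj2 (IHx _ _ bz y)).
  - exact: (proj2 (IHy _ _ bz)).
  - exact: (proj1 (IHy _ _ bz)).
  - exact: (proj1 (IHx _ _ bz y)).
move=> Hu Hv; rewrite game_ge0E /gle game_le0E; split=> nge g.
  case/opt_add=> [[v' v'P ->]|[_ /opt_opp[u' u'P ->] ->]].
    rewrite (Hv _ _ v'P); apply: nge; apply/opt_add; right.
    by exists (- v') => //; apply/opt_opp; exists v'.
  by rewrite (Hu _ _ u'P); apply: nge; apply/opt_add; left; exists u'.
case/opt_add=> [[u' u'P ->]|[_ /opt_opp[v' v'P ->] ->]].
  rewrite -[game_le0 _]/(gle _ _) -(Hu _ _ u'P).
  apply: nge; apply/opt_add; right.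
  by exists (- u') => //; apply/opt_opp; exists u'.
rewrite -[game_le0 _]/(gle _ _) -(Hv _ _ v'P).
by apply: nge; apply/opt_add; left; exists v'.
Qed.

(** Conway's recursive definition of the order, from which everything else
    about the order is derived. *)
Lemma gleE x y :
  gle x y <-> (forall x', opt false x x' -> ~ gle y x') /\
              (forall y', opt true y y' -> ~ gle y' x).
Proof.
rewrite {1}/gle game_le0E; split=> [nge|[nx ny] g].
  split=> z zP; rewrite -game_ge0_sub; apply: nge; apply/opt_add.
    by left; exists z.
  by right; exists (- z) => //; apply/opt_opp; exists z.
case/opt_add=> [[x' x'P ->]|[_ /opt_opp[y' y'P ->] ->]]; rewrite game_ge0_sub.
  exact: nx.
exact: ny.
Qed.

Lemma gle_refl x : gle x x.
Proof.
elim/game_ind_opt: x => x IH; apply/gleE; split=> x' x'P /gleE[] h1 h2.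
  exact: h1 _ x'P (IH _ _ x'P).
exact: h2 _ x'P (IH _ _ x'P).
Qed.

Lemma gle_opt_left x x' : opt false x x' -> ~ gle x x'.
Proof. by move=> x'P; move/gleE: (gle_refl x) => [h _]; apply: h. Qed.

Lemma gle_opt_right x x' : opt true x x' -> ~ gle x' x.
Proof. by move=> x'P; move/gleE: (gle_refl x) => [_ h]; apply: h. Qed.

(** If [x' >= z] for a left option [x'] of [x], then [y <= z <= x'] would
    refute [x <= y]; right options of [z] are symmetric. The triples that
    occur are rotations of [(x, y, z)] with one component replaced by an
    option, so the three rotations are proved together. *)
Lemma gle_trans y x z : gle x y -> gle y z -> gle x z.
Proof.
pose T x y z := gle x y -> gle y z -> gle x z.
suff: [/\ T x y z, T y z x & T z x y] by case.
elim/game_ind_opt: x y z => x IHx; elim/game_ind_opt => y IHy.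
elim/game_ind_opt => z IHz.
suff H u v w : (forall b u', opt b u u' -> T v w u') ->
               (forall b w', opt b w w' -> T w' u v) -> T u v w.
  split; apply: H => b t tP.
  - by case: (IHx _ _ tP y z).
  - by case: (IHz _ _ tP).
  - by case: (IHy _ _ tP z).
  - by case: (IHx _ _ tP y z).
  - by case: (IHz _ _ tP).
  - by case: (IHy _ _ tP z).
move=> Hu Hw uv vw; apply/gleE; split=> t tP tle.
  by move/gleE: uv => [h _]; apply: (h _ tP); apply: Hu tP vw tle.
by move/gleE: vw => [_ h]; apply: (h _ tP); apply: Hw tP tle uv.
Qed.

Lemma gle_match x y :
  (forall x', opt false x x' -> exists2 y', opt false y y' & gle x' y') ->
  (forall y', opt true y y' -> exists2 x', opt true x x' & gle x' y') ->
  gle x y.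
Proof.
move=> hx hy; apply/gleE; split=> [x' /hx[y' yP xy] yx|y' /hy[x' xP xy] yx].
  exact: gle_opt_left yP (gle_trans yx xy).
exact: gle_opt_right xP (gle_trans xy yx).
Qed.

Lemma game_eqP x y : game_eq x y <-> gle x y /\ gle y x.
Proof. by rewrite /game_eq /game_eq0 game_ge0_sub; split=> -[]. Qed.

Lemma game_ltP x y : game_lt x y <-> gle x y /\ ~ gle y x.
Proof. by rewrite /game_lt /game_lt0 game_ge0_sub. Qed.

#[local] Instance game_eq_equiv : Equivalence game_eq.
Proof.
split=> [x|x y|x y z]; rewrite !game_eqP.
- by split; apply: gle_refl.
- by case.
- by case=> xy yx [yz zy]; split; [apply: gle_trans yz|apply: gle_trans yx].
Qed.

(** The source of all identities between sums and products of games, the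
    induction hypotheses being equalities between options. *)
Lemma game_eq_match x y :
  (forall b x', opt b x x' -> exists2 y', opt b y y' & game_eq x' y') ->
  (forall b y', opt b y y' -> exists2 x', opt b x x' & game_eq y' x') ->
  game_eq x y.
Proof.
move=> hx hy; apply/game_eqP; split; apply: gle_match => z.
- by case/hx => t tP /game_eqP[? ?]; exists t.
- by case/hy => t tP /game_eqP[? ?]; exists t.
- by case/hy => t tP /game_eqP[? ?]; exists t.
- by case/hx => t tP /game_eqP[? ?]; exists t.
Qed.

Lemma game_addC x y : game_eq (x + y) (y + x).
Proof.
elim/game_ind_opt: x y => x IHx; elim/game_ind_opt => y IHy.
apply: game_eq_match => b g /opt_add[] [t tP ->].
- by exists (y + t); [apply/opt_add; right; exists t|apply: IHx tP _].
- by exists (t + x); [apply/opt_add; left; exists t|apply: IHy tP].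
- by exists (x + t); [apply/opt_add; right; exists t|symmetry; apply: IHy tP].
- by exists (t + y); [apply/opt_add; left; exists t|symmetry; apply: IHx tP _].
Qed.

Lemma opt_addl b x y x' : opt b x x' -> opt b (x + y) (x' + y).
Proof. by move=> xP; apply/opt_add; left; exists x'. Qed.

Lemma opt_addr b x y y' : opt b y y' -> opt b (x + y) (x + y').
Proof. by move=> xP; apply/opt_add; right; exists y'. Qed.

Lemma game_addA x y z : game_eq (x + (y + z)) (x + y + z).
Proof.
elim/game_ind_opt: x y z => x IHx; elim/game_ind_opt => y IHy.
elim/game_ind_opt => z IHz.
apply: game_eq_match => b g /opt_add[] [t tP ->].
- by exists (t + y + z); [apply/opt_addl/opt_addl|apply: IHx tP _ _].
- case/opt_add: tP => -[{}t tP ->].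
    by exists (x + t + z); [apply/opt_addl/opt_addr|apply: IHy tP _].
  by exists (x + y + t); [apply/opt_addr|apply: IHz tP].
- case/opt_add: tP => -[{}t tP ->].
    by exists (t + (y + z)); [apply/opt_addl|symmetry; apply: IHx tP _ _].
  by exists (x + (t + z)); [apply/opt_addr/opt_addl|symmetry; apply: IHy tP _].
- by exists (x + (y + t)); [apply/opt_addr/opt_addr|symmetry; apply: IHz tP].
Qed.

Lemma game_addx0 x : game_eq (x + game0) x.
Proof.
elim/game_ind_opt: x => x IHx; apply: game_eq_match => b g.
  case/opt_add=> -[t tP ->]; last by case: (opt_game0 tP).
  by exists t => //; apply: IHx tP.
by move=> gP; exists (g + game0); [apply/opt_addl|symmetry; apply: IHx gP].
Qed.

(** Reflexivity of the order says that [x - x] is both [>= 0] and [<= 0] in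
    the sense of the original sign predicates; it remains to compare these
    with the order relative to the zero game. *)
Lemma game_subxx x : game_eq (x - x) game0.
Proof.
have le0 g : (gle g game0 <-> game_le0 g) /\ (gle game0 g <-> game_ge0 g).
  elim/game_ind_opt: g => g IH; rewrite !gleE game_le0E game_ge0E.
  split; split.
  - by case=> h _ g' gP /(IH _ _ gP).2; apply: h.
  - move=> h; split=> g' gP; last by case: (opt_game0 gP).
    by move/(IH _ _ gP).2; apply: h.
  - by case=> _ h g' gP /(IH _ _ gP).1; apply: h.
  - move=> h; split=> g' gP; first by case: (opt_game0 gP).
    by move/(IH _ _ gP).1; apply: h.
apply/game_eqP; rewrite (le0 _).1 (le0 _).2 game_ge0_sub.
by split; apply: gle_refl.
Qed.

(** Monotonicity and cancellation have to be proved together, because the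
    order refers to itself negatively. *)
Lemma gle_add2r z x y : gle (x + z) (y + z) <-> gle x y.
Proof.
suff: (gle (x + z) (y + z) <-> gle x y) /\
      (gle (y + z) (x + z) <-> gle y x) by case.
elim/game_ind_opt: x y z => x IHx; elim/game_ind_opt => y IHy.
elim/game_ind_opt => z IHz.
suff H u v : (forall b z', opt b z z' -> gle u v -> gle (u + z') (v + z')) ->
   (forall b u', opt b u u' -> gle (v + z) (u' + z) <-> gle v u') ->
   (forall b v', opt b v v' -> gle (v' + z) (u + z) <-> gle v' u) ->
   gle (u + z) (v + z) <-> gle u v.
  split; apply: H => b t tP.
  - by move/((IHz _ _ tP).1).
  - exact: (IHx _ _ tP y z).2.
  - exact: (IHy _ _ tP z).2.
  - by move/((IHz _ _ tP).2).
  - exact: (IHy _ _ tP z).1.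
  - exact: (IHx _ _ tP y z).1.
move=> Hz Hu Hv; split=> uv; last first.
  apply/gleE; split=> g /opt_add[] [t tP ->].
  - by rewrite (Hu _ _ tP); move/gleE: uv => [h _]; apply: h.
  - move=> h; apply: (@gle_opt_left (v + z) (v + t)); first exact: opt_addr.
    exact: gle_trans h (Hz _ _ tP uv).
  - by rewrite (Hv _ _ tP); move/gleE: uv => [_ h]; apply: h.
  - move=> h; apply: (@gle_opt_right (u + z) (u + t)); first exact: opt_addr.
    exact: gle_trans (Hz _ _ tP uv) h.
move/gleE: uv => [h1 h2]; apply/gleE; split=> t tP.
  by rewrite -(Hu _ _ tP); apply/h1/opt_addl.
by rewrite -(Hv _ _ tP); apply/h2/opt_addl.
Qed.

(** * The ordered group of values of games *)

(** Linear identities between values are decided by comparing integer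
    coefficients: [abel] reads both sides as terms over a list of atoms. It
    plays in abelian groups the role that [ring] plays in rings. *)
Inductive zterm := ZVar of nat | ZZero | ZAdd of zterm & zterm | ZOpp of zterm.

Fixpoint zeval (V : zmodType) (e : seq V) (t : zterm) : V :=
  match t with
  | ZVar n => e`_n
  | ZZero => 0
  | ZAdd s t => zeval e s + zeval e t
  | ZOpp t => - zeval e t
  end%R.

Fixpoint zcoef (t : zterm) (i : nat) : int :=
  match t with
  | ZVar n => (n == i)%:Z
  | ZZero => 0
  | ZAdd s t => zcoef s i + zcoef t i
  | ZOpp t => - zcoef t i
  end%R.

Lemma zevalE (V : zmodType) (e : seq V) t :
  zeval e t = (\sum_(i < size e) e`_i *~ zcoef t i)%R.
Proof.
elim: t => [n||s IHs t IHt|t IHt] /=.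
- case: (ltnP n (size e)) => [lt_n|ge_n].
    rewrite (bigD1 (Ordinal lt_n)) //= eqxx mulr1z big1 ?addr0 // => i.
    by rewrite -val_eqE eq_sym /= => /negbTE ->; rewrite mulr0z.
  rewrite nth_default // big1 // => i _.
  case: eqP => [ni|_]; last exact: mulr0z.
  by move: ge_n; rewrite ni leqNgt ltn_ord.
- by rewrite big1 // => i _; rewrite mulr0z.
- by rewrite IHs IHt -big_split; apply: eq_bigr => i _; rewrite mulrzDr.
- by rewrite IHt -sumrN; apply: eq_bigr => i _; rewrite mulrNz.
Qed.

Lemma zeval_eq (V : zmodType) (e : seq V) s t :
  all (fun i => zcoef s i == zcoef t i) (iota 0 (size e)) ->
  zeval e s = zeval e t.
Proof.
move=> /allP st; rewrite !zevalE; apply: eq_bigr => i _.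
by rewrite (eqP (st i _)) // mem_iota ltn_ord.
Qed.

Ltac index_of x e :=
  match e with
  | x :: _ => constr:(0%N)
  | _ :: ?e' => let n := index_of x e' in constr:(n.+1)
  end.
Ltac atoms_of e t :=
  lazymatch t with
  | (?a + ?b)%R => let e' := atoms_of e a in atoms_of e' b
  | (- ?a)%R => atoms_of e a
  | 0%R => e
  | _ => match e with
         | _ => let _ := index_of t e in e
         | _ => constr:(t :: e)
         end
  end.
Ltac zterm_of e t :=
  lazymatch t with
  | (?a + ?b)%R =>
    let s := zterm_of e a in let t := zterm_of e b in constr:(ZAdd s t)
  | (- ?a)%R => let s := zterm_of e a in constr:(ZOpp s)
  | 0%R => constr:(ZZero)
  | _ => let n := index_of t e in constr:(ZVar n)
  end.
Ltac abel :=
  lazymatch goal with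
  | |- @eq ?V ?a ?b =>
    let e := atoms_of (@nil V) a in
    let e := atoms_of e b in
    let s := zterm_of e a in
    let t := zterm_of e b in
    exact: (@zeval_eq _ e s t isT)
  end.

(** All games, not just numbers: the options of a product of numbers can then
    be compared in an abelian group before the product is known to be a
    number. *)
Definition gvalue : Type := {c : game -> Prop | exists x, c = game_eq x}.

Bind Scope ring_scope with gvalue.

Definition value (x : game) : gvalue :=
  exist _ (game_eq x) (ex_intro _ x (erefl (game_eq x))).

Lemma valueP x y : value x = value y <-> game_eq x y.
Proof.
split=> [[->]|xy]; first by reflexivity.
apply: eq_exist => /=; apply/funext => z; apply/propext.
split=> [xz|]; last by transitivity y.
by transitivity x => //; symmetry.
Qed.

Definition vrepr (v : gvalue) : game := sval (cid (proj2_sig v)).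

Lemma vreprK : cancel vrepr value.
Proof.
case=> c cP; rewrite /vrepr; case: cid => x /= ex.
by apply: eq_exist; rewrite ex.
Qed.

HB.instance Definition _ := gen_eqMixin gvalue.
HB.instance Definition _ := gen_choiceMixin gvalue.

Definition vadd (u v : gvalue) := value (vrepr u + vrepr v).
Definition vopp (v : gvalue) := value (- vrepr v).

Lemma game_add_eq2r z x y : game_eq (x + z) (y + z) <-> game_eq x y.
Proof. by rewrite !game_eqP !gle_add2r. Qed.

Lemma vaddE x y : vadd (value x) (value y) = value (x + y).
Proof.
apply/valueP; transitivity (x + vrepr (value y)).
  by rewrite game_add_eq2r; apply/valueP/vreprK.
transitivity (vrepr (value y) + x); first exact: game_addC.
transitivity (y + x); last exact: game_addC.
by rewrite game_add_eq2r; apply/valueP/vreprK.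
Qed.

Lemma vaddA : associative vadd.
Proof.
move=> u v w; rewrite -[u]vreprK -[v]vreprK -[w]vreprK !vaddE.
exact/valueP/game_addA.
Qed.

Lemma vaddC : commutative vadd.
Proof.
move=> u v; rewrite -[u]vreprK -[v]vreprK !vaddE.
exact/valueP/game_addC.
Qed.

Lemma vadd0 : left_id (value game0) vadd.
Proof.
move=> u; rewrite vaddC -[u]vreprK vaddE.
exact/valueP/game_addx0.
Qed.

Lemma vaddN : left_inverse (value game0) vopp vadd.
Proof.
move=> u; rewrite vaddC -{1}[u]vreprK vaddE.
exact/valueP/game_subxx.
Qed.

HB.instance Definition _ :=
  GRing.isZmodule.Build gvalue vaddA vaddC vadd0 vaddN.

Lemma value0 : value game0 = 0%R. Proof. by []. Qed.

Lemma valueD x y : value (x + y) = (value x + value y)%R.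
Proof. by rewrite -vaddE. Qed.

Lemma valueN x : value (- x) = (- value x)%R.
Proof.
apply/eqP; rewrite -addr_eq0 addrC -valueD -value0.
exact/eqP/valueP/game_subxx.
Qed.

Lemma valueB x y : value (x - y) = (value x - value y)%R.
Proof. by rewrite valueD valueN. Qed.

Definition vge0 (v : gvalue) : Prop := gle game0 (vrepr v).
Definition vgt0 (v : gvalue) : Prop := vge0 v /\ v <> 0%R.

Lemma gle_value x x' y y' :
  value x = value x' -> value y = value y' -> gle x y <-> gle x' y'.
Proof.
move=> /valueP/game_eqP[xx' x'x] /valueP/game_eqP[yy' y'y].
by split=> xy; [apply: gle_trans x'x (gle_trans xy yy')
               |apply: gle_trans xx' (gle_trans xy y'y)].
Qed.

(** Since the order is invariant under translation, it is determined by the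
    cone of nonnegative values. *)
Lemma vge0P x y : vge0 (value y - value x)%R <-> gle x y.
Proof.
rewrite -valueB /vge0 -(gle_add2r x); apply: gle_value.
  by rewrite valueD value0; abel.
by rewrite valueD vreprK valueB; abel.
Qed.

Lemma vge0_0 : vge0 0%R.
Proof. by rewrite -(subrr 0%R) -value0 vge0P; apply: gle_refl. Qed.

Lemma vge0D u v : vge0 u -> vge0 v -> vge0 (u + v)%R.
Proof.
move=> u0 v0; have -> : (u + v = value (vrepr u) - value (- vrepr v))%R.
  by rewrite valueN !vreprK; abel.
apply/vge0P/(@gle_trans game0) => //; apply/vge0P.
by rewrite valueN vreprK value0 opprK add0r.
Qed.

Lemma vge0_anti v : vge0 v -> vge0 (- v)%R -> v = 0%R.
Proof.
move=> v0 Nv0; rewrite -[v]vreprK -value0; apply/valueP/game_eqP; split=> //.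
by apply/vge0P; rewrite vreprK value0 sub0r.
Qed.

Lemma vgt0P x y : vgt0 (value y - value x)%R <-> game_lt x y.
Proof.
rewrite game_ltP /vgt0 vge0P; split=> -[xy nyx]; split=> // h; apply: nyx.
  by apply/eqP; rewrite subr_eq0; apply/eqP/valueP/game_eqP.
rewrite -vge0P -opprB h oppr0; exact: vge0_0.
Qed.

Lemma vgt0W v : vgt0 v -> vge0 v. Proof. by case. Qed.

Lemma vgt0_ge0D u v : vgt0 u -> vge0 v -> vgt0 (u + v)%R.
Proof.
case=> u0 nu v0; split; first exact: vge0D.
move=> uv; apply: nu; apply: vge0_anti => //.
by rewrite -[X in vge0 X](_ : v = _)//; apply/eqP; rewrite -addr_eq0 addrC uv.
Qed.

Lemma vgt0D u v : vgt0 u -> vgt0 v -> vgt0 (u + v)%R.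
Proof. by move=> u0 /vgt0W; apply: vgt0_ge0D. Qed.

Lemma vgt0_asym v : vgt0 v -> ~ vge0 (- v)%R.
Proof. by case=> v0 nv Nv; apply/nv/vge0_anti. Qed.

(** * Ring identities for games, and numbers *)

Definition valueE := (valueB, valueD, valueN, value0).

Lemma opt_mul_intro b c d x y x' y' :
  opt c x x' -> opt d y y' -> b = c (+) d ->
  opt b (x * y) (x' * y + x * y' - x' * y').
Proof.
move=> xP yP ->; apply/opt_mul; exists c, x', y'; split=> //.
by rewrite addbC addbA addbb.
Qed.

Lemma value_match x y :
  (forall b x', opt b x x' -> exists2 y', opt b y y' & value x' = value y') ->
  (forall b y', opt b y y' -> exists2 x', opt b x x' & value y' = value x') ->
  value x = value y.
Proof.
move=> hx hy; apply/valueP/game_eq_match => b z zP.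
  by case: (hx _ _ zP) => t tP /valueP zt; exists t.
by case: (hy _ _ zP) => t tP /valueP zt; exists t.
Qed.

Lemma value_mulC x y : value (x * y) = value (y * x).
Proof.
elim/game_ind_opt: x y => x IHx; elim/game_ind_opt => y IHy.
apply: value_match => b g /opt_mul[c [t [u [tP uP ->]]]].
  exists (u * x + y * t - u * t).
    by apply: (opt_mul_intro uP tP); rewrite addbK.
  by rewrite !valueE (IHx _ _ tP y) (IHx _ _ tP u) (IHy _ _ uP); abel.
exists (u * y + x * t - u * t).
  by apply: (opt_mul_intro uP tP); rewrite addbK.
by rewrite !valueE (IHx _ _ uP y) (IHx _ _ uP t) (IHy _ _ tP); abel.
Qed.

Lemma value_mulNl x y : value (- x * y) = (- value (x * y))%R.
Proof.
rewrite -valueN.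
elim/game_ind_opt: x y => x IHx; elim/game_ind_opt => y IHy.
apply: value_match => b g.
  case/opt_mul=> [c [_ [y' [/opt_opp[x' xP ->] yP ->]]]].
  exists (- (x' * y + x * y' - x' * y')).
    apply/opt_opp; eexists=> //; apply: (opt_mul_intro xP yP).
    by case: (b); case: (c).
  by rewrite !valueE (IHx _ _ xP y) (IHx _ _ xP y') (IHy _ _ yP) !valueE; abel.
case/opt_opp=> [_ /opt_mul[c [x' [y' [xP yP ->]]]] ->].
exists (- x' * y + - x * y' - - x' * y').
  have xP' : opt (~~ c) (- x) (- x').
    by apply/opt_opp; exists x'; rewrite ?negbK.
  by apply: (opt_mul_intro xP' yP); case: (b); case: (c).
by rewrite !valueE (IHx _ _ xP y) (IHx _ _ xP y') (IHy _ _ yP) !valueE; abel.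
Qed.

Lemma value_mulNr x y : value (x * - y) = (- value (x * y))%R.
Proof. by rewrite value_mulC value_mulNl value_mulC. Qed.

(** The terms of an option of [x * (y + z)] that involve the component which
    has not moved cancel in the group of values, which leaves an option of
    [x * y + x * z]. *)
Lemma value_mulDr x y z :
  value (x * (y + z)) = (value (x * y) + value (x * z))%R.
Proof.
rewrite -valueD.
elim/game_ind_opt: x y z => x IHx; elim/game_ind_opt => y IHy.
elim/game_ind_opt => z IHz.
apply: value_match => b g.
  case/opt_mul=> [c [x' [_ [xP /opt_add[] [t tP ->] ->]]]].
    exists (x' * y + x * t - x' * t + x * z).
      by apply/opt_addl/(opt_mul_intro xP tP); rewrite addbC addbK.
    by rewrite !valueE !(IHx _ _ xP) (IHy _ _ tP) !valueE; abel.
  exists (x * y + (x' * z + x * t - x' * t)).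
    by apply/opt_addr/(opt_mul_intro xP tP); rewrite addbC addbK.
  by rewrite !valueE !(IHx _ _ xP) (IHz _ _ tP) !valueE; abel.
case/opt_add=> [[_ /opt_mul[c [x' [t [xP tP ->]]]] ->]|].
  exists (x' * (y + z) + x * (t + z) - x' * (t + z)).
    by apply: (opt_mul_intro xP (opt_addl z tP)); rewrite addbC addbK.
  by rewrite !valueE !(IHx _ _ xP) (IHy _ _ tP) !valueE; abel.
case=> [_ /opt_mul[c [x' [t [xP tP ->]]]] ->].
exists (x' * (y + z) + x * (y + t) - x' * (y + t)).
  by apply: (opt_mul_intro xP (opt_addr y tP)); rewrite addbC addbK.
by rewrite !valueE !(IHx _ _ xP) (IHz _ _ tP) !valueE; abel.
Qed.

Lemma value_mulDl x y z :
  value ((x + y) * z) = (value (x * z) + value (y * z))%R.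
Proof. by rewrite value_mulC value_mulDr !(value_mulC z). Qed.

Lemma value_mulBr x y z :
  value (x * (y - z)) = (value (x * y) - value (x * z))%R.
Proof. by rewrite value_mulDr value_mulNr. Qed.

Lemma value_mulBl x y z :
  value ((x - y) * z) = (value (x * z) - value (y * z))%R.
Proof. by rewrite value_mulDl value_mulNl. Qed.

Definition value_mulE :=
  (value_mulBr, value_mulBl, value_mulDr, value_mulDl, valueE).

(** Both products have one option for each choice of [x'], [y'] and [z'], on
    the side given by the product of the three signs; by distributivity these
    options have equal expansions. *)
Lemma value_mulA x y z : value (x * (y * z)) = value (x * y * z).
Proof.
elim/game_ind_opt: x y z => x IHx; elim/game_ind_opt => y IHy.
elim/game_ind_opt => z IHz.
apply: value_match => b g.
  case/opt_mul=> [c [x' [_ [xP /opt_mul[d [y' [z' [yP zP ->]]]] ->]]]].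
  have wP := opt_mul_intro xP yP erefl.
  eexists.
    by apply: (opt_mul_intro wP zP); case: (b); case: (c); case: (d).
  rewrite !value_mulE !(IHx _ _ xP) !(IHy _ _ yP) !(IHz _ _ zP).
  by abel.
case/opt_mul=> [c [_ [z' [/opt_mul[d [x' [y' [xP yP ->]]]] zP ->]]]].
have wP := opt_mul_intro yP zP erefl.
eexists; first by apply: (opt_mul_intro xP wP); case: (b); case: (c); case: (d).
rewrite !value_mulE !(IHx _ _ xP) !(IHy _ _ yP) !(IHz _ _ zP).
by abel.
Qed.

Lemma value_mulx0 x : value (x * game0) = 0%R.
Proof.
rewrite -value0; apply: value_match => b g; last by move/opt_game0.
by case/opt_mul=> [c [x' [t [_ /opt_game0]]]].
Qed.

Lemma value_mul0x x : value (game0 * x) = 0%R.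
Proof. by rewrite value_mulC value_mulx0. Qed.

Lemma value_mulx1 x : value (x * game1) = value x.
Proof.
elim/game_ind_opt: x => x IHx; apply: value_match => b g.
  case/opt_mul=> [c [x' [t [xP /opt_game1[bc ->] ->]]]].
  exists x'; first by case: (b) (c) bc xP => [] [].
  by rewrite !valueE !value_mulx0 (IHx _ _ xP); abel.
move=> gP; exists (g * game1 + x * game0 - g * game0).
  have g0 : opt false game1 game0 by apply/opt_game1.
  by apply: (opt_mul_intro gP g0); rewrite addbF.
by rewrite !valueE !value_mulx0 (IHx _ _ gP); abel.
Qed.

(** Multiplication by the sign of a side; [sgv b (value x - value x')] is
    positive when [x'] lies on the side [b] of [x]. *)
Definition sgv (b : bool) (v : gvalue) : gvalue := (if b then - v else v)%R.

Lemma is_numberE x :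
  is_number x <->
  (forall b x', opt b x x' -> is_number x') /\
  (forall l r, opt false x l -> opt true x r -> vgt0 (value r - value l)%R).
Proof.
case: x => L R xl xr /=; split=> [[nl nr lr]|[n lr]].
  by split=> [[] x' [i ->] //|l r [i ->] [j ->]]; apply/vgt0P.
by split=> [i|j|i j]; [apply: (n false)|apply: (n true)|apply/vgt0P/lr];
  eexists.
Qed.

Lemma number_opt b x x' : is_number x -> opt b x x' -> is_number x'.
Proof. by move=> /is_numberE[h _]; apply: h. Qed.

(** If a left option [l] of [x] had a left option [u >= x], then [l <= u] by
    induction would contradict the fact that no left option of [x] is [>= x].
    If [r <= l] for a right option [r] of [x], then [x] is not a number. *)
Lemma number_opt_gle x : is_number x ->
  (forall l, opt false x l -> gle l x) /\ (forall r, opt true x r -> gle x r).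
Proof.
elim/game_ind_opt: x => x IHx nx.
have lr l r : opt false x l -> opt true x r -> ~ gle r l.
  by move=> lP rP; case/is_numberE: nx => _ /(_ _ _ lP rP) /vgt0P/game_ltP[].
split=> t tP; apply/gleE; have nt := number_opt nx tP;
  have [IHl IHr] := IHx _ _ tP nt; split=> u uP h.
- exact: (gle_opt_left tP (gle_trans h (IHl _ uP))).
- exact: lr tP uP h.
- exact: lr uP tP h.
- exact: (gle_opt_right tP (gle_trans (IHr _ uP) h)).
Qed.

Lemma number_opt_gt0 b x x' :
  is_number x -> opt b x x' -> vgt0 (sgv b (value x - value x')).
Proof.
move=> /number_opt_gle[hl hr]; case: b => x'P /=.
  rewrite opprB; apply/vgt0P/game_ltP.
  by split; [apply: hr|apply: gle_opt_right].
by apply/vgt0P/game_ltP; split; [apply: hl|apply: gle_opt_left].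
Qed.

(** For sums and opposites it is easy to compare an option with the game
    itself; a left and a right option are then compared by transitivity. *)
Lemma number_crit x :
  (forall b x', opt b x x' -> is_number x') ->
  (forall b x', opt b x x' -> vgt0 (sgv b (value x - value x'))) ->
  is_number x.
Proof.
move=> nx x0; apply/is_numberE; split=> // l r /x0 /= lx /x0 /=.
rewrite opprB => xr.
have -> : (value r - value l =
           value r - value x + (value x - value l))%R.
  by abel.
exact: vgt0D.
Qed.

Lemma gle_cases x y :
  gle x y \/ (exists2 l, opt false x l & gle y l) \/
  (exists2 r, opt true y r & gle r x).
Proof.
have [xy|nxy] := pselect (gle x y); [by left|right].
have [|nl] := pselect (exists2 l, opt false x l & gle y l); [by left|right].
apply: contra_notP nxy => nr; apply/gleE; split=> z zP h.
  by apply: nl; exists z.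
by apply: nr; exists z.
Qed.

Lemma number_le_total x y :
  is_number x -> is_number y ->
  vge0 (value y - value x) \/ vge0 (value x - value y).
Proof.
move=> nx ny; rewrite !vge0P.
have [|[[l lP yl]|[r rP rx]]] := gle_cases x y; [by left|right..].
  by apply: gle_trans yl _; apply: (number_opt_gle nx).1.
by apply: gle_trans rx; apply: (number_opt_gle ny).2.
Qed.

Lemma number0 : is_number game0.
Proof. by apply: number_crit => b x' /opt_game0. Qed.

Lemma number1 : is_number game1.
Proof.
apply/is_numberE; split=> [b x'|l r _] /opt_game1[] // _ ->; exact: number0.
Qed.

Lemma numberD x y : is_number x -> is_number y -> is_number (x + y).
Proof.
elim/game_ind_opt: x y => x IHx; elim/game_ind_opt => y IHy nx ny.
apply: number_crit => b g /opt_add[] [t tP ->].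
- exact: IHx tP _ (number_opt nx tP) ny.
- exact: IHy tP nx (number_opt ny tP).
- move: (number_opt_gt0 nx tP); congr (vgt0 (sgv _ _)).
  by rewrite !valueD; abel.
- move: (number_opt_gt0 ny tP); congr (vgt0 (sgv _ _)).
  by rewrite !valueD; abel.
Qed.

Lemma numberN x : is_number x -> is_number (- x).
Proof.
elim/game_ind_opt: x => x IHx nx.
apply: number_crit => b g /opt_opp[t tP ->].
  exact: IHx tP (number_opt nx tP).
move: (number_opt_gt0 nx tP); congr vgt0; rewrite !valueN.
by case: (b) => /=; abel.
Qed.

Lemma numberB x y : is_number x -> is_number y -> is_number (x - y).
Proof. by move=> nx ny; apply: numberD => //; apply: numberN. Qed.

(** * Products of numbers *)

Definition option_of (y x : game) : Prop := exists b, opt b x y.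

Lemma option_of_wf : well_founded option_of.
Proof. by elim/game_ind_opt=> x IH; constructor=> y [b /IH]. Qed.

(** One step of the multiset ordering: an element is replaced by any finite
    list of its options. *)
Definition replaced (v u : seq game) : Prop :=
  exists l x r t, [/\ Permutation u (l ++ x :: r), List.Forall (option_of^~ x) t
                    & Permutation (l ++ t ++ r) v].

Definition simpler := clos_trans _ replaced.

(** The well-foundedness of the replacement of a list element in place carries
    over to multisets, because the statement proved by induction is already
    invariant under permutations. *)
Lemma simpler_wf : well_founded simpler.
Proof.
apply: wf_clos_trans => u.
suff: forall v, Permutation u v -> Acc replaced v.
  by apply; apply: Permutation_refl.
elim/(well_founded_ind (wf_list_ext _ _ option_of_wf)): u => u IH v uv.
constructor=> w [l [x [r [t [vx tx tw]]]]].
have uxs := Permutation_trans uv vx.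
have [l' [r' def_u]] := Permutation_vs_cons_inv
  (Permutation_trans uxs (Permutation_sym (Permutation_middle _ _ _))).
subst u; apply: (IH (l' ++ t ++ r')); first exact: list_ext_intro.
apply: Permutation_trans tw; apply/Permutation_app_middle.
exact: Permutation_app_inv uxs.
Qed.

Lemma simpler_replace l x r t v :
  List.Forall (option_of^~ x) t -> Permutation (l ++ t ++ r) v ->
  simpler v (l ++ x :: r).
Proof.
by move=> tx tv; constructor; exists l, x, r, t; split.
Qed.

Definition mul_number x y :=
  is_number x -> is_number y -> is_number (x * y).

(** Monotonicity is asserted only for pairs consisting of [y] and an option of
    [y], and equality also for the options of [y]: in this form no inductive
    hypothesis is needed in which both [y] and one of [x1] and [x2] have been
    replaced. *)
Definition mul_mono x1 x2 y :=
  is_number x1 -> is_number x2 -> is_number y ->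
  (value x1 = value x2 ->
   value (x1 * y) = value (x2 * y) /\
   forall b y', opt b y y' -> value (x1 * y') = value (x2 * y')) /\
  (vgt0 (value x2 - value x1) ->
   forall b y', opt b y y' -> vgt0 (sgv b (value ((x2 - x1) * (y - y'))))).

Lemma vle_cases x y : vge0 (value y - value x) ->
  value x = value y \/ vgt0 (value y - value x).
Proof.
move=> xy; case: (pselect (value x = value y)) => [|nxy]; [by left|right].
by split=> // /eqP; rewrite subr_eq0 => /eqP yx; apply: nxy.
Qed.

Lemma mul_mono_ge0 x1 x2 y b y' :
  mul_mono x1 x2 y -> is_number x1 -> is_number x2 -> is_number y ->
  vge0 (value x2 - value x1) -> opt b y y' ->
  vge0 (sgv b (value ((x2 - x1) * (y - y')))).
Proof.
move=> S n1 n2 ny /vle_cases[] x12 yP; have [Seq Slt] := S n1 n2 ny.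
  have [e /(_ _ _ yP) e'] := Seq x12.
  have -> : value ((x2 - x1) * (y - y')) = 0 by rewrite !value_mulE e e'; abel.
  by rewrite /sgv oppr0 if_same; apply: vge0_0.
exact/vgt0W/Slt.
Qed.

Lemma vge0_gt0D u v : vge0 u -> vgt0 v -> vgt0 (u + v).
Proof. by move=> u0 v0; rewrite addrC; apply: vgt0_ge0D. Qed.

(** A left option of [x * y], built from [x'] and [y'], against a right
    option, built from [x''] and [y''], when [x'] and [x''] are on the same
    side of [x]. Writing [P u v] for the value of [u * v], the difference has
    the two decompositions
      [P (x'' - x') (y - y')  + P (x - x'') (y'' - y')],
      [P (x'' - x') (y - y'') + P (x - x') (y'' - y')].
    The second terms are positive. One of the first terms is nonnegative:
    which one depends on the order of [x'] and [x''], as [y'] and [y''] are on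
    opposite sides of [y]. *)
Lemma mul_opt_same_side x y c x' x'' y' y'' :
  is_number x -> is_number y ->
  opt c x x' -> opt c x x'' -> opt c y y' -> opt (~~ c) y y'' ->
  mul_mono x' x'' y -> mul_mono x'' x' y ->
  mul_mono y' y'' x -> mul_mono y'' y' x ->
  vgt0 (value (x'' * y + x * y'' - x'' * y'') -
        value (x' * y + x * y' - x' * y')).
Proof.
move=> nx ny xP' xP'' yP' yP'' S12 S21 T12 T21.
have [nx' nx''] := (number_opt nx xP', number_opt nx xP'').
have [ny' ny''] := (number_opt ny yP', number_opt ny yP'').
have yy : vgt0 (sgv c (value y'' - value y')).
  have := vgt0D (number_opt_gt0 ny yP') (number_opt_gt0 ny yP'').
  by congr vgt0; case: (c) => /=; abel.
have pos t : opt c x t -> vgt0 (value ((x - t) * (y'' - y'))).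
  move=> tP; move: yy; case: (c) tP => /= tP yy.
    rewrite opprB in yy; move: ((T21 ny'' ny' nx).2 yy true _ tP) => /=.
    by congr vgt0; rewrite !value_mulE !(value_mulC x) !(value_mulC t); abel.
  move: ((T12 ny' ny'' nx).2 yy false _ tP) => /=.
  by congr vgt0; rewrite !value_mulE !(value_mulC x) !(value_mulC t); abel.
have D1 : vge0 (value ((x'' - x') * (y - y'))) ->
  vgt0 (value (x'' * y + x * y'' - x'' * y'') -
        value (x' * y + x * y' - x' * y')).
  move/vge0_gt0D => /(_ _ (pos _ xP'')).
  by congr vgt0; rewrite !value_mulE; abel.
have D2 : vge0 (value ((x'' - x') * (y - y''))) ->
  vgt0 (value (x'' * y + x * y'' - x'' * y'') -
        value (x' * y + x * y' - x' * y')).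
  move/vge0_gt0D => /(_ _ (pos _ xP')).
  by congr vgt0; rewrite !value_mulE; abel.
have swap z : vge0 (sgv true (value ((x' - x'') * z))) ->
    vge0 (value ((x'' - x') * z)).
  by congr vge0; rewrite /= !value_mulE; abel.
case: (number_le_total nx' nx'') => xx.
  have ge0 b t := @mul_mono_ge0 _ _ _ b t S12 nx' nx'' ny xx.
  by case: (c) yP' yP'' => /ge0 h1 /ge0 h2; [apply: D2|apply: D1].
have ge0 b t := @mul_mono_ge0 _ _ _ b t S21 nx'' nx' ny xx.
by case: (c) yP' yP'' => /ge0 h1 /ge0 h2; [apply/D1/swap|apply/D2/swap].
Qed.

(** A left option and a right option of [x * y] use options of [x] on the same
    side or options of [y] on the same side; the second case is the first one
    for [y * x]. *)
Lemma mul_number_step x y :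
  (forall b x', opt b x x' -> mul_number x' y) ->
  (forall b y', opt b y y' -> mul_number x y') ->
  (forall b c x' y', opt b x x' -> opt c y y' -> mul_number x' y') ->
  (forall b c x' x'', opt b x x' -> opt c x x'' -> mul_mono x' x'' y) ->
  (forall b c y' y'', opt b y y' -> opt c y y'' -> mul_mono y' y'' x) ->
  mul_number x y.
Proof.
move=> Nx Ny Nxy Sx Sy nx ny; apply/is_numberE; split=> [b g|l r].
  case/opt_mul=> c [x' [y' [xP yP ->]]].
  have [nx' ny'] := (number_opt nx xP, number_opt ny yP).
  by apply: numberB; [apply: numberD|];
    [apply: Nx xP _ _|apply: Ny yP _ _|apply: Nxy xP yP _ _].
case/opt_mul=> [c [x' [y' [xP' yP' ->]]]].
case/opt_mul=> [d [x'' [y'' [xP'' yP'' ->]]]].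
case: (eqVneq c d) xP'' yP'' => [<-|cd] xP'' yP''.
  by apply: (@mul_opt_same_side _ _ c) => //;
    [apply: (Sx c c)|apply: (Sx c c)|apply: (Sy c (~~ c))|apply: (Sy (~~ c) c)].
(* Here [y'] and [y''] are on the same side. *)
have dE : d = ~~ c by case: (c) (d) cd => [] [].
rewrite dE /= negbK in xP'' yP''.
have := @mul_opt_same_side y x c y' y'' x' x'' ny nx yP' yP'' xP' xP''
  (Sy _ _ _ _ yP' yP'') (Sy _ _ _ _ yP'' yP')
  (Sx _ _ _ _ xP' xP'') (Sx _ _ _ _ xP'' xP').
congr vgt0; rewrite !value_mulE.
by rewrite !(value_mulC y) !(value_mulC y') !(value_mulC y''); abel.
Qed.

(** Each game lies strictly between the left and the right options of the
    other, and this already forces equality. *)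
Lemma value_eq_opt x y :
  (forall b g, opt b x g -> vgt0 (sgv b (value y - value g))) ->
  (forall b g, opt b y g -> vgt0 (sgv b (value x - value g))) ->
  value x = value y.
Proof.
suff H s t : (forall b g, opt b s g -> vgt0 (sgv b (value t - value g))) ->
    (forall b g, opt b t g -> vgt0 (sgv b (value s - value g))) -> gle s t.
  by move=> hx hy; apply/valueP/game_eqP; split; apply: H.
move=> hs ht; apply/gleE.
split=> g /[dup] gP; [move/hs|move/ht] => /= /vgt0_asym h.
  by move/vge0P => g0; apply: h; rewrite opprB.
by rewrite opprK in h => /vge0P.
Qed.

(** If [x1] and [x2] are equal, the options of either product are on the
    correct side of the other product. If [x1 < x2], some option [m] of [x1]
    or of [x2] satisfies [x1 <= m <= x2]; cut the factor [x2 - x1] at [m]. One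
    part is covered by the hypothesis on smaller triples, and the other
    compares a product with one of its options, which are in the right order
    because the product is a number. *)
Lemma mul_mono_step x1 x2 y :
  mul_number x1 y -> mul_number x2 y ->
  (forall b y', opt b y y' -> mul_mono x1 x2 y') ->
  (forall b x1', opt b x1 x1' -> mul_mono x1' x2 y /\ mul_mono x2 x1' y) ->
  (forall b x2', opt b x2 x2' -> mul_mono x1 x2' y /\ mul_mono x2' x1 y) ->
  mul_mono x1 x2 y.
Proof.
move=> N1 N2 Sy S1 S2 n1 n2 ny; split=> [x12|x12 b y' yP].
  have Eopt b y' : opt b y y' -> value (x1 * y') = value (x2 * y').
    by move=> yP; case: (Sy _ _ yP n1 n2 (number_opt ny yP)) => /(_ x12)[].
  split=> //.
  have H s t b g : is_number s -> is_number t -> value s = value t ->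
      (forall b y', opt b y y' -> value (s * y') = value (t * y')) ->
      (forall b s', opt b s s' -> mul_mono s' t y /\ mul_mono t s' y) ->
      opt b (s * y) g -> vgt0 (sgv b (value (t * y) - value g)).
    move=> ns nt st Est S /opt_mul[c [s' [y' [sP yP ->]]]].
    have ns' := number_opt ns sP; have [S12 S21] := S _ _ sP.
    have := number_opt_gt0 ns sP; rewrite st; case: (c) sP yP => /= sP yP s'0.
      rewrite opprB in s'0; have := (S21 nt ns' ny).2 s'0 _ _ yP.
      congr vgt0; rewrite !value_mulE (Est _ _ yP).
      by case: (b) => /=; abel.
    have := (S12 ns' nt ny).2 s'0 _ _ yP.
    congr vgt0; rewrite !value_mulE (Est _ _ yP).
    by case: (b) => /=; abel.
  apply: value_eq_opt => b g; first exact: H.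
  by apply: H => // c z zP; [rewrite (Eopt _ _ zP)|case: (S2 _ _ zP)].
have nle : ~ gle x2 x1.
  by move/vge0P => h; apply: (vgt0_asym x12); rewrite opprB.
have [//|[[m mP /vge0P m0]|[m mP /vge0P m0]]] := gle_cases x2 x1.
  have := mul_mono_ge0 (S2 _ _ mP).1 n1 (number_opt n2 mP) ny m0 yP.
  have := number_opt_gt0 (N2 n2 ny) (opt_mul_intro mP yP erefl).
  move=> /vgt0_ge0D h /h; congr vgt0; rewrite !value_mulE.
  by case: (b) => /=; abel.
have := mul_mono_ge0 (S1 _ _ mP).1 (number_opt n1 mP) n2 ny m0 yP.
have := number_opt_gt0 (N1 n1 ny) (opt_mul_intro mP yP erefl).
move=> /vgt0_ge0D h /h; congr vgt0; rewrite !value_mulE.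
by case: (b) => /=; abel.
Qed.

(** Lists of length two and three index the two kinds of statements, so that
    they can be proved by a single induction on multisets of games. *)
Lemma mul_number_mono u :
  match u with
  | [:: x; y] => mul_number x y
  | [:: x1; x2; y] => mul_mono x1 x2 y
  | _ => True
  end.
Proof.
elim/(well_founded_ind simpler_wf): u => u.
have F b x x' : opt b x x' -> List.Forall (option_of^~ x) [:: x'].
  by move=> xP; do !constructor; exists b.
have F2 b c x x' x'' : opt b x x' -> opt c x x'' ->
    List.Forall (option_of^~ x) [:: x'; x''].
  by move=> xP xP'; do !constructor; [exists b|exists c].
case: u => [|x1 [|x2 [|y []]]] // IH.
  apply: mul_number_step =>
    [b x' xP|b y' yP|b c x' y' xP yP|b c x' x'' xP xP'|b c y' y'' yP yP'].
  - apply: (IH [:: x'; x2]).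
    by apply: (@simpler_replace [::] _ [:: x2]) (F _ _ _ xP) _.
  - apply: (IH [:: x1; y']).
    by apply: (@simpler_replace [:: x1] _ [::]) (F _ _ _ yP) _.
  - apply: (IH [:: x'; y']).
    apply: (t_trans _ _ _ [:: x'; x2]).
      by apply: (@simpler_replace [:: x'] _ [::]) (F _ _ _ yP) _.
    by apply: (@simpler_replace [::] _ [:: x2]) (F _ _ _ xP) _.
  - apply: (IH [:: x'; x''; x2]).
    by apply: (@simpler_replace [::] _ [:: x2]) (F2 _ _ _ _ _ xP xP') _.
  - apply: (IH [:: y'; y''; x1]).
    apply: (@simpler_replace [:: x1] _ [::]) (F2 _ _ _ _ _ yP yP') _.
    exact: (Permutation_app_comm [:: x1]).
apply: mul_mono_step => [||b y' yP|b x' xP|b x' xP].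
- apply: (IH [:: x1; y]).
  by apply: (@simpler_replace [:: x1] _ [:: y] [::]).
- apply: (IH [:: x2; y]).
  by apply: (@simpler_replace [::] _ [:: x2; y] [::]).
- apply: (IH [:: x1; x2; y']).
  by apply: (@simpler_replace [:: x1; x2] _ [::]) (F _ _ _ yP) _.
- split.
    apply: (IH [:: x'; x2; y]).
    by apply: (@simpler_replace [::] _ [:: x2; y]) (F _ _ _ xP) _.
  apply: (IH [:: x2; x'; y]).
  apply: (@simpler_replace [::] _ [:: x2; y]) (F _ _ _ xP) _.
  exact: perm_swap.
split.
  apply: (IH [:: x1; x'; y]).
  by apply: (@simpler_replace [:: x1] _ [:: y]) (F _ _ _ xP) _.
apply: (IH [:: x'; x1; y]).
apply: (@simpler_replace [:: x1] _ [:: y]) (F _ _ _ xP) _.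
exact: perm_swap.
Qed.

Lemma numberM x y : is_number x -> is_number y -> is_number (x * y).
Proof. exact: (mul_number_mono [:: x; y]). Qed.

Lemma value_eq_mull x x' y :
  is_number x -> is_number x' -> is_number y ->
  value x = value x' -> value (x * y) = value (x' * y).
Proof.
move=> n n' ny e.
by case: (mul_number_mono [:: x; x'; y] n n' ny) => /(_ e)[].
Qed.

(** A positive [y] has a left option [l >= 0], [x * l >= 0] by induction, and
    [x * (y - l) > 0] by monotonicity. *)
Lemma value_mul_gt0 x y :
  is_number x -> is_number y ->
  vgt0 (value x) -> vgt0 (value y) -> vgt0 (value (x * y)).
Proof.
move=> nx ny x0; elim/game_ind_opt: y ny => y IHy ny y0.
have nle : ~ gle y game0.
  by move/vge0P; rewrite value0 sub0r; apply: vgt0_asym.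
have [//|[[l lP /vge0P]|[r /opt_game0//]]] := gle_cases y game0.
rewrite value0 subr0 => l0; have nl := number_opt ny lP.
have xl0 : vge0 (value (x * l)).
  move: (@vle_cases game0 l); rewrite value0 subr0 => /(_ l0)[l00|l_gt0].
    rewrite value_mulC -(value_eq_mull number0) // ?value0 // value_mul0x.
    exact: vge0_0.
  by apply/vgt0W/(IHy _ _ lP).
have := (mul_number_mono [:: game0; x; y] number0 nx ny).2.
rewrite value0 subr0 => /(_ x0 _ _ lP) /= /vgt0_ge0D /(_ xl0).
by congr vgt0; rewrite !value_mulE !value_mul0x; abel.
Qed.

(** * The ordered ring of surreal numbers *)

Local Close Scope game_scope.
Bind Scope ring_scope with surreal.

(** The proof of [is_number x] is an argument since [surreal] only contains
    the classes of numbers; [class_ofP] shows that it does not matter. *)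
Definition class_of x (nx : is_number x) : surreal :=
  exist _ (number_class x) (ex_intro2 _ _ x nx erefl).

Lemma surrealP (a : surreal) : exists x (nx : is_number x), a = class_of nx.
Proof.
by case: a => c cP; have [x nx cx] := cP; exists x, nx; apply: eq_exist.
Qed.

Lemma representsP x (nx : is_number x) y :
  represents y (class_of nx) <-> is_number y /\ value x = value y.
Proof. by rewrite /represents /= /number_class valueP. Qed.

Lemma class_ofP x y (nx : is_number x) (ny : is_number y) :
  class_of nx = class_of ny <-> value x = value y.
Proof.
split=> [|xy].
  move=> e; have /representsP[_ ->//] : represents y (class_of nx).
  by rewrite e; apply/representsP.
apply: eq_exist => /=; apply/funext => z; apply/propext.
by rewrite /number_class -!valueP xy.
Qed.

Definition srepr (a : surreal) : game := sval (cid (surrealP a)).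

Lemma srepr_number a : is_number (srepr a).
Proof. by rewrite /srepr; case: cid => x /= []. Qed.

Lemma class_of_srepr a : class_of (srepr_number a) = a.
Proof.
suff: forall x (nx : is_number x), srepr a = x -> class_of nx = a by apply.
rewrite /srepr; case: cid => x /= [nx e] y ny xy.
by rewrite e; apply/class_ofP; rewrite xy.
Qed.

Lemma value_srepr x (nx : is_number x) : value (srepr (class_of nx)) = value x.
Proof. by apply/(class_ofP (srepr_number _) nx)/class_of_srepr. Qed.

HB.instance Definition _ := gen_eqMixin surreal.
HB.instance Definition _ := gen_choiceMixin surreal.

Definition sadd a b := class_of (numberD (srepr_number a) (srepr_number b)).
Definition sopp a := class_of (numberN (srepr_number a)).
Definition smul a b := class_of (numberM (srepr_number a) (srepr_number b)).

(** The operations are computed on chosen representatives; any other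
    representatives give the same class. For the product this is
    [value_eq_mull]. *)
Section ClassOf.
Variables (x y : game) (nx : is_number x) (ny : is_number y).

Lemma saddE : sadd (class_of nx) (class_of ny) = class_of (numberD nx ny).
Proof. by apply/class_ofP; rewrite !valueD !value_srepr. Qed.

Lemma soppE : sopp (class_of nx) = class_of (numberN nx).
Proof. by apply/class_ofP; rewrite !valueN !value_srepr. Qed.

Lemma smulE : smul (class_of nx) (class_of ny) = class_of (numberM nx ny).
Proof.
have [nx' ny'] := (srepr_number (class_of nx), srepr_number (class_of ny)).
apply/class_ofP; rewrite (value_eq_mull nx' nx ny') ?value_srepr //.
by rewrite value_mulC (value_eq_mull ny' ny nx) ?value_srepr // value_mulC.
Qed.

End ClassOf.

Lemma saddA : associative sadd.
Proof.
move=> a b c; case: (surrealP a) (surrealP b) (surrealP c)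
  => [x [nx ->]] [y [ny ->]] [z [nz ->]].
by rewrite !saddE; apply/class_ofP; rewrite !valueD addrA.
Qed.

Lemma saddC : commutative sadd.
Proof.
move=> a b; case: (surrealP a) (surrealP b) => [x [nx ->]] [y [ny ->]].
by rewrite !saddE; apply/class_ofP; rewrite !valueD addrC.
Qed.

Lemma sadd0 : left_id (class_of number0) sadd.
Proof.
move=> a; case: (surrealP a) => [x [nx ->]].
by rewrite saddE; apply/class_ofP; rewrite !valueE add0r.
Qed.

Lemma saddN : left_inverse (class_of number0) sopp sadd.
Proof.
move=> a; case: (surrealP a) => [x [nx ->]].
by rewrite soppE saddE; apply/class_ofP; rewrite !valueE addNr.
Qed.

HB.instance Definition _ :=
  GRing.isZmodule.Build surreal saddA saddC sadd0 saddN.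

Lemma smulA : associative smul.
Proof.
move=> a b c; case: (surrealP a) (surrealP b) (surrealP c)
  => [x [nx ->]] [y [ny ->]] [z [nz ->]].
by rewrite !smulE; apply/class_ofP; rewrite value_mulA.
Qed.

Lemma smulC : commutative smul.
Proof.
move=> a b; case: (surrealP a) (surrealP b) => [x [nx ->]] [y [ny ->]].
by rewrite !smulE; apply/class_ofP; rewrite value_mulC.
Qed.

Lemma smul1 : left_id (class_of number1) smul.
Proof.
move=> a; case: (surrealP a) => [x [nx ->]].
by rewrite smulE; apply/class_ofP; rewrite value_mulC value_mulx1.
Qed.

Lemma smulDl : left_distributive smul +%R.
Proof.
move=> a b c; case: (surrealP a) (surrealP b) (surrealP c)
  => [x [nx ->]] [y [ny ->]] [z [nz ->]].
rewrite -[LHS]/(smul (sadd _ _) _) -[RHS]/(sadd (smul _ _) (smul _ _)).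
by rewrite saddE !smulE saddE; apply/class_ofP; rewrite value_mulDl valueD.
Qed.

Lemma value1_gt0 : vgt0 (value game1).
Proof.
rewrite -[value game1]subr0 -value0.
apply: (number_opt_gt0 (b := false) number1).
exact/opt_game1.
Qed.

Lemma sone_neq0 : class_of number1 != 0%R.
Proof.
by apply/eqP => /class_ofP e; have [_ []] := value1_gt0; rewrite e.
Qed.

HB.instance Definition _ :=
  GRing.Zmodule_isComNzRing.Build surreal smulA smulC smul1 smulDl sone_neq0.

(** Being a unit is decided classically at this stage, so that the ring
    structure is available in the construction of inverses. *)
Definition sunit : {pred surreal} :=
  [pred a | `[< exists b : surreal, b * a = 1 >]]%R.
Definition sinv (a : surreal) : surreal :=
  if pselect (exists b : surreal, b * a = 1)%R is left ab then sval (cid ab)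
  else a.

Lemma smulV : {in sunit, left_inverse 1%R sinv *%R}.
Proof.
move=> a /asboolP ab; rewrite /sinv; case: pselect => // ab'.
by case: cid.
Qed.

Lemma sunitP a b : (b * a = 1)%R -> sunit a.
Proof. by move=> ba; apply/asboolP; exists b. Qed.

Lemma sinv_out : {in [predC sunit], sinv =1 id}.
Proof.
by move=> a /asboolPn nab; rewrite /sinv; case: pselect.
Qed.

HB.instance Definition _ :=
  GRing.ComNzRing_hasMulInverse.Build surreal smulV sunitP sinv_out.

Lemma class_ofD x y (nx : is_number x) (ny : is_number y) :
  (class_of nx + class_of ny)%R = class_of (numberD nx ny).
Proof. exact: saddE. Qed.

Lemma class_ofN x (nx : is_number x) :
  (- class_of nx)%R = class_of (numberN nx).
Proof. exact: soppE. Qed.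

Lemma class_ofB x y (nx : is_number x) (ny : is_number y) :
  (class_of nx - class_of ny)%R = class_of (numberB nx ny).
Proof. by rewrite class_ofN class_ofD; apply/class_ofP. Qed.

Lemma class_ofM x y (nx : is_number x) (ny : is_number y) :
  (class_of nx * class_of ny)%R = class_of (numberM nx ny).
Proof. exact: smulE. Qed.

Definition sge0 (a : surreal) : bool := `[< vge0 (value (srepr a)) >].
Definition sle (a b : surreal) : bool := sge0 (b - a)%R.
Definition snorm (a : surreal) : surreal := (if sge0 a then a else - a)%R.

Lemma sge0P x (nx : is_number x) : sge0 (class_of nx) <-> vge0 (value x).
Proof.
by rewrite /sge0; split=> [/asboolP|h]; [|apply/asboolP]; rewrite value_srepr.
Qed.

Lemma sleP x y (nx : is_number x) (ny : is_number y) :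
  sle (class_of nx) (class_of ny) <-> vge0 (value y - value x).
Proof. by rewrite /sle class_ofB sge0P valueB. Qed.

Lemma sgt0P x (nx : is_number x) :
  class_of nx <> 0%R /\ sge0 (class_of nx) <-> vgt0 (value x).
Proof. by rewrite class_ofP sge0P /vgt0 value0; split=> -[]. Qed.

Lemma sge0_total (a : surreal) : sge0 a || sge0 (- a)%R.
Proof.
case: (surrealP a) => [x [nx ->]]; rewrite class_ofN; apply/orP.
have := number_le_total number0 nx; rewrite value0 subr0 sub0r -valueN.
by case=> h; [left|right]; apply/sge0P.
Qed.

Lemma smul_gt0 (a b : surreal) :
  a <> 0%R -> b <> 0%R -> sge0 a -> sge0 b -> (a * b)%R <> 0%R /\ sge0 (a * b).
Proof.
case: (surrealP a) (surrealP b) => [x [nx ->]] [y [ny ->]].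
move=> x0 y0 gx gy; rewrite class_ofM; apply/sgt0P/value_mul_gt0 => //.
  exact/(sgt0P nx).
exact/(sgt0P ny).
Qed.

Lemma smul_eq0 : GRing.integral_domain_axiom surreal.
Proof.
move=> a b ab0; apply: contra_eqT ab0; rewrite negb_or => /andP[a0 b0].
wlog ga : a a0 / sge0 a.
  move=> H; case/orP: (sge0_total a); first exact: H.
  by move/H; rewrite oppr_eq0 mulNr oppr_eq0; apply.
wlog gb : b b0 / sge0 b.
  move=> H; case/orP: (sge0_total b); first exact: H.
  by move/H; rewrite oppr_eq0 mulrN oppr_eq0; apply.
by apply/eqP; case: (@smul_gt0 a b) => //; apply/eqP.
Qed.

HB.instance Definition _ := GRing.ComUnitRing_isIntegral.Build surreal smul_eq0.

Lemma sge0_anti (a : surreal) : sge0 a -> sge0 (- a) -> a = 0.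
Proof.
case: (surrealP a) => [x [nx ->]]; rewrite class_ofN !sge0P valueN => x0 Nx0.
exact/class_ofP/vge0_anti.
Qed.

Lemma sge0_0 : sge0 0.
Proof. by apply/(sge0P number0)/vge0_0. Qed.

Lemma sle0E (a : surreal) : sle 0 a = sge0 a. Proof. by rewrite /sle subr0. Qed.

Lemma sle0_add (a b : surreal) : sle 0 a -> sle 0 b -> sle 0 (a + b).
Proof.
rewrite !sle0E; case: (surrealP a) (surrealP b) => [x [nx ->]] [y [ny ->]].
by rewrite class_ofD !sge0P valueD; apply: vge0D.
Qed.

Lemma sle0_mul (a b : surreal) : sle 0 a -> sle 0 b -> sle 0 (a * b).
Proof.
rewrite !sle0E => a0 b0.
case: (eqVneq a 0) => [->|/eqP na]; first by rewrite mul0r sge0_0.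
case: (eqVneq b 0) => [->|/eqP nb]; first by rewrite mulr0 sge0_0.
by case: (smul_gt0 na nb a0 b0).
Qed.

Lemma sle0_anti (a : surreal) : sle 0 a -> sle a 0 -> a = 0.
Proof. by rewrite sle0E /sle sub0r; apply: sge0_anti. Qed.

Lemma ssub_ge0 (a b : surreal) : sle 0 (b - a) = sle a b.
Proof. by rewrite /sle subr0. Qed.

Lemma sle0_total (a : surreal) : sle 0 a || sle a 0.
Proof. by rewrite /sle subr0 sub0r sge0_total. Qed.

Lemma snormN (a : surreal) : snorm (- a) = snorm a.
Proof.
rewrite /snorm opprK; case: ifP => Na; case: ifP => // ga.
  by rewrite (sge0_anti ga Na) oppr0.
by have := sge0_total a; rewrite ga Na.
Qed.

Lemma sge0_norm (a : surreal) : sle 0 a -> snorm a = a.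
Proof. by rewrite sle0E /snorm => ->. Qed.

HB.instance Definition _ := Num.IntegralDomain_isLeReal.Build surreal
  sle0_add sle0_mul sle0_anti ssub_ge0 sle0_total snormN sge0_norm
  (fun _ _ => erefl).

Lemma class_of_lt x y (nx : is_number x) (ny : is_number y) :
  class_of nx < class_of ny <-> vgt0 (value y - value x).
Proof.
rewrite -valueB -(sgt0P (numberB ny nx)) -class_ofB -subr_gt0 lt_def.
rewrite -[0 <= _]/(sle 0 _) sle0E.
by split=> [/andP[/eqP]|[/eqP-> ->]].
Qed.

Lemma class_of_le x y (nx : is_number x) (ny : is_number y) :
  class_of nx <= class_of ny <-> gle x y.
Proof. by rewrite -vge0P -(sleP nx ny). Qed.

Lemma represents_class x a :
  represents x a -> exists nx : is_number x, a = class_of nx.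
Proof.
case: (surrealP a) => [y [ny ->]] /representsP[nx e].
by exists nx; apply/class_ofP.
Qed.

Lemma represents_ex x : is_number x -> exists a, represents x a.
Proof. by move=> nx; exists (class_of nx); apply/representsP. Qed.

Lemma represents_fun x a b : represents x a -> represents x b -> a = b.
Proof.
by move=> /represents_class[nx ->] /represents_class[nx' ->]; apply/class_ofP.
Qed.

Lemma represents_number x a : represents x a -> is_number x.
Proof. by case/represents_class. Qed.

Lemma represents0 : represents game0 0.
Proof. exact/(representsP number0). Qed.

Lemma represents1 : represents game1 1.
Proof. exact/(representsP number1). Qed.

Section Represents.
Variables (x y : game) (a b : surreal).
Hypotheses (xa : represents x a) (yb : represents y b).

Lemma representsD : represents (x + y)%game (a + b).
Proof.
case/represents_class: xa => nx ->; case/represents_class: yb => ny ->.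
by rewrite class_ofD; apply/representsP; split=> //; apply: numberD.
Qed.

Lemma representsB : represents (x - y)%game (a - b).
Proof.
case/represents_class: xa => nx ->; case/represents_class: yb => ny ->.
by rewrite class_ofB; apply/representsP; split=> //; apply: numberB.
Qed.

Lemma representsM : represents (x * y)%game (a * b).
Proof.
case/represents_class: xa => nx ->; case/represents_class: yb => ny ->.
by rewrite class_ofM; apply/representsP; split=> //; apply: numberM.
Qed.

Lemma represents_lt : a < b <-> vgt0 (value y - value x).
Proof.
case/represents_class: xa => nx ->; case/represents_class: yb => ny ->.
exact: class_of_lt.
Qed.

Lemma represents_le : a <= b <-> gle x y.
Proof.
case/represents_class: xa => nx ->; case/represents_class: yb => ny ->.
exact: class_of_le.
Qed.

End Represents.

Lemma represents_opt x a b x' a' : represents x a -> opt b x x' ->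
  represents x' a' -> if b then a < a' else a' < a.
Proof.
move=> xa xP xa'; have := number_opt_gt0 (represents_number xa) xP.
case: (b) => /=; last by move/(represents_lt xa' xa).
by rewrite opprB => /(represents_lt xa xa').
Qed.

(** * Inverses *)

(** The construction of the inverse of [x] relative to a family [o] of options
    of [x] that contains all the positive ones, with inverses [w] and sides
    [side]. An approximation of the inverse is indexed by the list of the
    options used to build it. *)
Section Inverse.
Variables (x : game) (K : Type) (o w : K -> game) (side : K -> bool).

Fixpoint inv_val (s : seq K) : game :=
  if s is k :: s then ((game1 + (o k - x) * inv_val s) * w k)%game else game0.

(** The approximation [0] is below the inverse, and only left options of [x]
    exchange the two sides, since [x' - x] is negative for them. *)
Fixpoint inv_side (s : seq K) : bool :=
  if s is k :: s then (if side k then inv_side s else ~~ inv_side s) else false.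

Definition game_inv : game :=
  Game (fun i : {s | inv_side s = false} => inv_val (sval i))
       (fun j : {s | inv_side s = true} => inv_val (sval j)).

Lemma opt_game_inv b g :
  opt b game_inv g <-> exists2 s, inv_side s = b & g = inv_val s.
Proof.
by case: b; split=> [[[s sb] ->]|[s sb ->]];
  [exists s|exists (exist _ s sb)|exists s|exists (exist _ s sb)].
Qed.

Variables (X : surreal) (O W : K -> surreal).
Hypotheses (xX : represents x X) (X0 : 0 < X).
Hypothesis oO : forall k, represents (o k) (O k).
Hypothesis wW : forall k, represents (w k) (W k).
Hypothesis WO : forall k, W k * O k = 1.
Hypothesis O0 : forall k, 0 < O k.
Hypothesis o_opt : forall k, opt (side k) x (o k).
Hypothesis opt_o : forall b x' X', opt b x x' -> represents x' X' -> 0 < X' ->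
  exists2 k, side k = b & o k = x'.

Fixpoint inv_class (s : seq K) : surreal :=
  if s is k :: s then (1 + (O k - X) * inv_class s) * W k else 0.

Lemma represents_inv_val s : represents (inv_val s) (inv_class s).
Proof.
elim: s => [|k s IH] /=; first exact: represents0.
apply: representsM => //; apply: representsD; first exact: represents1.
by apply: representsM => //; apply: representsB.
Qed.

(** One step of the recursion multiplies [1 - X V] by [(O k - X) * W k], which
    is negative exactly for left options. *)
Lemma inv_class_side s :
  if inv_side s then 1 < X * inv_class s else X * inv_class s < 1.
Proof.
elim: s => [|k s IH] /=; first by rewrite mulr0 ltr01.
have W0 : 0 < W k by rewrite -(pmulr_lgt0 _ (O0 k)) WO ltr01.
have e : 1 - X * ((1 + (O k - X) * inv_class s) * W k) =
         (O k - X) * (1 - X * inv_class s) * W k.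
  by rewrite -{1}(WO k); ring.
have := represents_opt xX (o_opt k) (oO k).
case: (side k); case: (inv_side s) IH => /= V1 Xk.
- by rewrite -subr_lt0 e pmulr_llt0 // pmulr_rlt0 ?subr_gt0 // subr_lt0.
- by rewrite -subr_gt0 e pmulr_lgt0 // pmulr_rgt0 ?subr_gt0.
- by rewrite -subr_gt0 e pmulr_lgt0 // nmulr_rgt0 ?subr_lt0.
- by rewrite -subr_lt0 e pmulr_llt0 // nmulr_rlt0 ?subr_lt0 // subr_gt0.
Qed.

Lemma game_inv_number : is_number game_inv.
Proof.
apply/is_numberE; split=> [b g|l r] /opt_game_inv[s sb ->].
  exact: represents_number (represents_inv_val s).
case/opt_game_inv=> t tb ->.
apply/(represents_lt (represents_inv_val s) (represents_inv_val t)).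
rewrite -(ltr_pM2l X0); have := inv_class_side s; have := inv_class_side t.
by rewrite sb tb => /[swap]; apply: lt_trans.
Qed.

(** Let [x'] be an option of [x], and [V] one of the approximations. If
    [x' > 0], the option of the product is [1 + x' (Y - V'')], where [V''] is
    the next approximation built from [V] and [x']. If [x' <= 0], then [x'] is
    a left option, and in [x' (Y - V) + x V] the first term is zero or has the
    sign of [V - Y], and the second is on the corresponding side of [1]. So
    [1] lies between the options of the product; the product is positive,
    hence not at most the left option [0] of [1]. *)
Lemma mul_game_inv Y : represents game_inv Y -> X * Y = 1.
Proof.
move=> yY.
have Vs s : if inv_side s then Y < inv_class s else inv_class s < Y.
  apply: represents_opt yY _ (represents_inv_val s).
  by apply/opt_game_inv; exists s.
have optG b g : opt b (x * game_inv)%game g ->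
    exists2 G, represents g G & if b then 1 < G else G < 1.
  case/opt_mul=> [c [x' [_ [xP /opt_game_inv[s sb ->] ->]]]].
  have [X' xX'] := represents_ex (number_opt (represents_number xX) xP).
  have sV := represents_inv_val s.
  eexists.
    by apply: representsB (representsM xX' sV); apply: representsD;
      [apply: representsM xX' yY|apply: representsM xX sV].
  case: (ltrP 0 X') => X'0.
    (* The sign of [Y - V''] is read off from the side of [k :: s]. *)
    have [k kc ok] := opt_o xP xX' X'0.
    have OX' : O k = X' by apply: represents_fun xX'; rewrite -ok.
    have -> : X' * Y + X * inv_class s - X' * inv_class s =
      1 + X' * (Y - inv_class (k :: s)).
      have -> : X' * (Y - inv_class (k :: s)) =
        X' * Y - (1 + (X' - X) * inv_class s) * (W k * O k).
        by rewrite /= OX'; ring.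
      by rewrite WO; ring.
    have /= := Vs (k :: s); rewrite kc sb.
    have -> : (if c then b (+) c else ~~ (b (+) c)) = ~~ b.
      by case: (b); case: (c).
    case: (b) => /= h.
      by rewrite ltrDl pmulr_rgt0 // subr_gt0.
    by rewrite gtrDl pmulr_rlt0 // subr_lt0.
  have cF : c = false.
    case: (c) xP => // /(represents_opt xX) /(_ xX') /(lt_trans X0).
    by rewrite ltNge X'0.
  have := Vs s; have := inv_class_side s; rewrite sb cF addbF.
  case: (b) => h1 h2; nra.
have xyXY := representsM xX yY.
have Y0 : 0 < Y by have := Vs [::].
apply/eqP; rewrite eq_le; apply/andP; split.
  apply/(represents_le xyXY represents1)/gleE.
  split=> g; last by case/opt_game1.
  by case/optG=> G gG G1 /(represents_le represents1 gG); rewrite leNgt G1.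
apply/(represents_le represents1 xyXY)/gleE; split=> g.
  case/opt_game1=> _ -> /(represents_le xyXY represents0).
  by rewrite leNgt mulr_gt0.
by case/optG=> G gG G1 /(represents_le gG represents1); rewrite leNgt G1.
Qed.

End Inverse.

(** Induction on [x]: the inverses of the positive options are chosen, and
    right options are all positive. *)
Lemma represents_inv x X : represents x X -> 0 < X ->
  exists y Y, represents y Y /\ Y * X = 1.
Proof.
elim/game_ind_opt: x X => -[L R xl xr] IH X xX X0.
pose K := ({i : L | vgt0 (value (xl i))} + R)%type.
pose o (k : K) := match k with inl i => xl (sval i) | inr j => xr j end.
pose side (k : K) := if k is inr _ then true else false.
have o_opt k : opt (side k) (Game xl xr) (o k).
  by case: k => [[i ?]|j]; [exists i|exists j].
have /choice[O oO] k : exists Ok, represents (o k) Ok.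
  by apply/represents_ex/(number_opt (represents_number xX) (o_opt k)).
have pos i (a : surreal) : represents i a -> (0 < a <-> vgt0 (value i)).
  by move=> ia; rewrite (represents_lt represents0 ia) value0 subr0.
have O0 k : 0 < O k.
  case: k => [[i i0]|j]; first by apply/(pos _ _ (oO _)).
  exact: lt_trans X0 (represents_opt xX (o_opt (inr j)) (oO _)).
have /choice[w /choice[W wW]] k :
    exists wk Wk, represents wk Wk /\ Wk * O k = 1.
  exact: IH (o_opt k) _ (oO k) (O0 k).
have rw k : represents (w k) (W k) by case: (wW k).
have WO k : W k * O k = 1 by case: (wW k).
have opt_o b x' X' : opt b (Game xl xr) x' -> represents x' X' -> 0 < X' ->
    exists2 k, side k = b & o k = x'.
  case: b => -[i ->] iX' X'0; first by exists (inr i).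
  by exists (inl (exist _ i ((pos _ _ iX').1 X'0))).
have ny := @game_inv_number _ K o w side X O W xX X0 oO rw WO O0 o_opt.
have [Y yY] := represents_ex ny.
exists (game_inv (Game xl xr) o w side), Y; split=> //.
by rewrite mulrC; apply: mul_game_inv yY.
Qed.

Lemma surreal_fieldP : GRing.field_axiom surreal.
Proof.
move=> a; rewrite neq_lt => /orP aN0; apply/unitrPr.
have inv_ex (c : surreal) : 0 < c -> exists d, c * d = 1.
  case: (surrealP c) => x [nx ->] c0.
  have [|y [Y [_ e]]] := @represents_inv x _ _ c0; first exact/representsP.
  by exists Y; rewrite mulrC.
case: aN0 => [a0|/inv_ex//]; case: (inv_ex (- a)); first by rewrite oppr_gt0.
by move=> d e; exists (- d); rewrite mulrN -mulNr.
Qed.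

HB.instance Definition _ := GRing.UnitRing_isField.Build surreal surreal_fieldP.

Theorem corollary3p11 :
  Equivalence game_eq /\
  exists struct : Num.RealField surreal,
    let No : realFieldType := Num.RealField.Pack struct in
    [/\ represents game0 (0 : No),
        represents game1 (1 : No),
        forall (a b : No) (x y : game),
          represents x a -> represents y b ->
          represents (game_add x y) (a + b),
        forall (a b : No) (x y : game),
          represents x a -> represents y b ->
          represents (game_mul x y) (a * b)
      & forall (a b : No) (x y : game),
          represents x a -> represents y b ->
          (a < b <-> game_lt x y)].
Proof.
split; first exact: game_eq_equiv.
exists (Num.RealField.class surreal); split.
- exact: represents0.
- exact: represents1.
- by move=> a b x y; apply: representsD.
- by move=> a b x y; apply: representsM.
- by move=> a b x y xa yb; rewrite -vgt0P; apply: represents_lt.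
Qed.
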